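(* Let $n\ge1$. The decomposable cone $C$ linearly spans a dense subspace of $\ell^p(\mathcal I_n)$ for $1\le p<\infty$ (and likewise of $c_0(\mathcal I_n)$); indeed its algebraic span contains every finitely supported sequence. Equivalently, the Plücker image of the Grassmannian lies in no closed hyperplane: the homogeneous ideal of the Grassmannian begins in degree $2$.
   Context: Scalars are complex. $\mathcal I_n=\binom{\mathbb N}{n}$ is the set of $n$-element subsets of $\mathbb N$. Let $E$ be $\ell^p$ ($1\le p<\infty$) or $c_0$. The decomposable cone $C\subset E(\mathcal I_n)$ is the set of families $\omega=(p_I)$ satisfying the quadratic Plücker relations $\sum_{t=1}^{n+1}(-1)^t\,\tilde p_{R s_t}\,\tilde p_{s_1\cdots\widehat{s_t}\cdots s_{n+1}}=0$ for all $(n-1)$-tuples $R$ and $(n+1)$-tuples $(s_1,\dots,s_{n+1})$ of indices, where $\tilde p$ is the alternating extension of $(p_I)$ to ordered tuples (zero on repeated indices); equivalently, $C$ consists of $0$ and the Plücker coordinate families $p_I=\det(v_r(i_s))_{r,s}$, $I=\{i_1<\dots<i_n\}$, of linearly independent $v_1,\dots,v_n\in E(\mathbb N)$. The Plücker image is the image of $C\setminus\{0\}$ in the projective space $\mathbb P(E(\mathcal I_n))$. ''The homogeneous ideal begins in degree $2$'' means that no nonzero degree-$1$ form (continuous linear functional) vanishes on the Plücker image. *)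

(* Defs.v *)
From HB Require Import structures.
From mathcomp Require Import all_boot all_order all_algebra.
From mathcomp Require Import finmap complex ring.
From mathcomp Require Import all_classical all_reals all_analysis.

Set Implicit Arguments.
Unset Strict Implicit.
Unset Printing Implicit Defensive.

Import Order.TTheory GRing.Theory Num.Theory.
Import numFieldNormedType.Exports.
Import ComplexField.Normc.

Local Open Scope classical_set_scope.
Local Open Scope ring_scope.
Local Open Scope complex_scope.

(* The choice of E among l^p (1 <= p < oo) and c_0. *)
Inductive space_kind (R : realType) : Type :=
| ell (p : R) of 1 <= p
| c_zero.
Arguments ell {R} p _.
Arguments c_zero {R}.

Section SpaceNorm.
Variables (R : realType) (X : choiceType).
Implicit Types (E : space_kind R) (x y : X -> R[i]).

Definition psum (p : R) x : \bar R :=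
  \esum_(i in [set: X]) (normc (x i) `^ p)%:E.

Definition in_space E x : Prop :=
  match E with
  | ell p _ => (psum p x < +oo)%E
  | c_zero => forall eps : R, 0 < eps -> finite_set [set i | eps <= normc (x i)]
  end.

Definition space_norm E x : R :=
  match E with
  | ell p _ => fine (psum p x) `^ p^-1
  | c_zero => sup [set normc (x i) | i in [set: X]]
  end.

Lemma normc_ge0 (z : R[i]) : 0 <= normc z.
Proof. by case: z => a b; exact: sqrtr_ge0. Qed.

Lemma normc_triangle (z w : R[i]) : normc (z + w) <= normc z + normc w.
Proof. exact: le_normcD. Qed.

Lemma psum_ge0 p x : (0 <= psum p x)%E.
Proof. by apply: esum_ge0 => i _; rewrite lee_fin powR_ge0. Qed.

Lemma esumZ_le (c : R) (f : X -> R) : 0 <= c -> (forall i, 0 <= f i) ->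
  (\esum_(i in [set: X]) (c * f i)%:E <=
   c%:E * \esum_(i in [set: X]) (f i)%:E)%E.
Proof.
move=> c0 f0; apply: ge_ereal_sup => _ [A [finA _] <-].
under eq_fsbigr do rewrite EFinM.
rewrite -ge0_mule_fsumr; last by move=> i; rewrite lee_fin.
apply: lee_wpmul2l; first by rewrite lee_fin.
by apply: ereal_sup_ubound; exists A => //; split.
Qed.

Lemma powR_div (z w p : R) : 0 <= z -> 0 < w ->
  (z / w) `^ p = z `^ p / w `^ p.
Proof.
move=> z0 w0; rewrite powRM ?invr_ge0 ?(ltW w0)//; congr (_ * _).
rewrite -powR_inv1 ?(ltW w0)// -powRrM mulrC powRrM.
by rewrite powR_inv1// powR_ge0.
Qed.

Lemma psumZ_le p (a : R[i]) x : 0 < p ->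
  (psum p (a *: x) <= (normc a `^ p)%:E * psum p x)%E.
Proof.
move=> p0; apply: le_trans (esumZ_le _ _); [|exact: powR_ge0|by move=> i; exact: powR_ge0].
apply: le_esum => i _.
by rewrite lee_fin /GRing.scale/= normcM powRM ?normc_ge0.
Qed.

Lemma psum_norm p (p1 : 1 <= p) x : (psum p x < +oo)%E ->
  psum p x = (space_norm (ell p p1) x `^ p)%:E.
Proof.
move=> xf; have p0 : 0 < p by exact: (lt_le_trans ltr01 p1).
have fx : psum p x \is a fin_num by rewrite ge0_fin_numE ?psum_ge0.
rewrite /= -powRrM mulVf ?gt_eqF// powRr1 ?fineK//.
by rewrite fine_ge0 ?psum_ge0.
Qed.

Lemma psum_norm_le p (p1 : 1 <= p) x (M : R) : 0 <= M ->
  (psum p x <= (M `^ p)%:E)%E ->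
  (psum p x < +oo)%E /\ space_norm (ell p p1) x <= M.
Proof.
move=> M0 xM; have p0 : 0 < p by exact: (lt_le_trans ltr01 p1).
have xf : (psum p x < +oo)%E by exact: le_lt_trans xM (ltry _).
have fx : psum p x \is a fin_num by rewrite ge0_fin_numE ?psum_ge0.
split=> //=; rewrite -[leRHS]powRr1// -(@mulfV _ p) ?gt_eqF// powRrM.
apply: ge0_ler_powR; rewrite ?nnegrE ?invr_ge0 ?powR_ge0 ?(ltW p0)//.
  by rewrite fine_ge0 ?psum_ge0.
by rewrite -lee_fin fineK.
Qed.

Lemma ell_norm0_eq0 p (p1 : 1 <= p) x : (psum p x < +oo)%E ->
  space_norm (ell p p1) x = 0 -> x = 0.
Proof.
move=> xf x0; have p0 : 0 < p by exact: (lt_le_trans ltr01 p1).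
have := psum_norm p1 xf; rewrite x0 powR0 ?gt_eqF// => xs.
apply/funext => i; apply: eq0_normc.
have : ((normc (x i) `^ p)%:E <= psum p x)%E.
  rewrite -(@esum_set1 _ _ i (fun j => (normc (x j) `^ p)%:E)); last first.
    by rewrite lee_fin powR_ge0.
  rewrite /psum (esumID [set i] [set: X]); last first.
    by move=> j _; rewrite lee_fin powR_ge0.
  by rewrite setTI leeDl// esum_ge0// => j _; rewrite lee_fin powR_ge0.
rewrite xs lee_fin => le0.
have /eqP : normc (x i) `^ p = 0 by apply/eqP; rewrite eq_le le0 powR_ge0.
by rewrite powR_eq0 => /andP[/eqP].
Qed.

Lemma ellD p (p1 : 1 <= p) x y :
  (psum p x < +oo)%E -> (psum p y < +oo)%E ->
  (psum p (x + y)%R < +oo)%E /\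
  space_norm (ell p p1) (x + y) <=
  space_norm (ell p p1) x + space_norm (ell p p1) y.
Proof.
move=> xf yf; have p0 : 0 < p by exact: (lt_le_trans ltr01 p1).
set s := space_norm _ x; set t := space_norm _ y.
have s0 : 0 <= s by exact: powR_ge0.
have t0 : 0 <= t by exact: powR_ge0.
have xs : space_norm (ell p p1) x = s := erefl.
have yt : space_norm (ell p p1) y = t := erefl.
have xE := psum_norm p1 xf; have yE := psum_norm p1 yf.
rewrite xs in xE; rewrite yt in yE.
have x0 := ell_norm0_eq0 (p1 := p1) xf; have y0 := ell_norm0_eq0 (p1 := p1) yf.
rewrite xs in x0; rewrite yt in y0; clearbody s t.
have [sz|sn] := eqVneq s 0.
  have -> : x + y = y by rewrite (x0 sz) add0r.
  by split; [exact: yf | rewrite yt lerDr].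
have [tz|tn] := eqVneq t 0.
  have -> : x + y = x by rewrite (y0 tz) addr0.
  by split; [exact: xf | rewrite xs lerDl].
have {}s0 : 0 < s by rewrite lt_neqAle eq_sym sn.
have {}t0 : 0 < t by rewrite lt_neqAle eq_sym tn.
have st0 : 0 < s + t by exact: addr_gt0.
have stn : s + t != 0 by rewrite gt_eqF.
apply: psum_norm_le; first exact: ltW.
pose u := s / (s + t); pose v := t / (s + t).
have u0 : 0 <= u by rewrite divr_ge0 ?ltW.
have v0 : 0 <= v by rewrite divr_ge0 ?ltW.
have uv : u + v = 1 by rewrite -mulrDl mulfV ?gt_eqF.
have vE : v = 1 - u by rewrite -uv addrC addKr.
have u1 : u <= 1 by rewrite -uv lerDl.
pose a := (s + t) `^ p * u / s `^ p; pose b := (s + t) `^ p * v / t `^ p.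
have a0 : 0 <= a.
  by apply: divr_ge0; [apply: mulr_ge0; [exact: powR_ge0|]|exact: powR_ge0].
have b0 : 0 <= b.
  by apply: divr_ge0; [apply: mulr_ge0; [exact: powR_ge0|]|exact: powR_ge0].
have key i : normc ((x + y) i) `^ p <=
    a * normc (x i) `^ p + b * normc (y i) `^ p.
  have xs0 : 0 <= normc (x i) / s by rewrite divr_ge0 ?normc_ge0 ?ltW.
  have yt0 : 0 <= normc (y i) / t by rewrite divr_ge0 ?normc_ge0 ?ltW.
  have h : normc ((x + y) i) <=
      (s + t) * (u * (normc (x i) / s) + v * (normc (y i) / t)).
    apply: (le_trans (normc_triangle _ _)).
    rewrite le_eqVlt; apply/orP; left; apply/eqP; rewrite /u /v.
    by field; rewrite stn tn sn.
  apply: (le_trans (ge0_ler_powR _ _ _ h)); rewrite ?nnegrE ?normc_ge0 ?(ltW p0)//.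
    by apply: mulr_ge0; [exact: ltW|apply: addr_ge0; exact: mulr_ge0].
  rewrite powRM; [|exact: ltW|by apply: addr_ge0; exact: mulr_ge0].
  have cv : (u * (normc (x i) / s) + v * (normc (y i) / t)) `^ p <=
      u * (normc (x i) / s) `^ p + v * (normc (y i) / t) `^ p.
    rewrite vE; apply: (convex_powR p1 (Itv01 u0 u1));
      by rewrite inE/= in_itv/= andbT.
  apply: (le_trans (ler_wpM2l (powR_ge0 _ _) cv)).
  rewrite !powR_div ?normc_ge0//.
  by rewrite [leLHS](_ : _ = a * normc (x i) `^ p + b * normc (y i) `^ p) ?lexx// /a /b; ring.
have sp : s `^ p != 0 by rewrite powR_eq0 negb_and sn.
have tp : t `^ p != 0 by rewrite powR_eq0 negb_and tn.
apply: (@le_trans _ _ (a%:E * psum p x + b%:E * psum p y)%E); last first.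
  rewrite xE yE -!EFinM -EFinD lee_fin.
  rewrite /a /b !divfK// -mulrDr uv mulr1//.
apply: (@le_trans _ _
  (\esum_(i in [set: X]) (a * normc (x i) `^ p)%:E +
   \esum_(i in [set: X]) (b * normc (y i) `^ p)%:E)%E).
  rewrite -esumD; last 2 first.
  - by move=> i _; rewrite lee_fin mulr_ge0 ?powR_ge0.
  - by move=> i _; rewrite lee_fin mulr_ge0 ?powR_ge0.
  by apply: le_esum => i _; rewrite -EFinD lee_fin.
by apply: leeD; apply: esumZ_le => // i; exact: powR_ge0.
Qed.

Lemma c_zero_le x i : in_space c_zero x -> normc (x i) <= space_norm c_zero x.
Proof.
move=> cx; apply: sup_upper_bound; last by exists i.
split; first by exists (normc (x i)), i.
have fin := cx 1 ltr01.
exists (1 + \sum_(j <- fset_set [set i | 1 <= normc (x i)]) normc (x j)) => _ [j _ <-].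
have [xj|/ltW xj] := leP 1 (normc (x j)); last first.
  by rewrite (le_trans xj)// lerDl sumr_ge0// => k _; exact: normc_ge0.
rewrite (big_fsetD1 j)/=; last by rewrite in_fset_set// inE.
by rewrite addrCA lerDl addr_ge0// sumr_ge0// => k _; exact: normc_ge0.
Qed.

Lemma c_zero_ub x (M : R) : 0 <= M -> (forall i, normc (x i) <= M) ->
  space_norm c_zero x <= M.
Proof.
move=> M0 xM; have [/= [_ [i _ _]]|/nonemptyPn x0] :=
  pselect ([set normc (x i) | i in [set: X]] !=set0).
  by apply: ge_sup; [exists (normc (x i)), i | move=> _ [j _ <-]].
by rewrite /= x0 sup0.
Qed.

Lemma space_norm_ge0 E x : in_space E x -> 0 <= space_norm E x.
Proof.
case: E => [p p1 _|cx]; first exact: powR_ge0.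
have [[_ [i _ _]]|/nonemptyPn x0] :=
  pselect ([set normc (x i) | i in [set: X]] !=set0).
  exact: le_trans (normc_ge0 _) (c_zero_le i cx).
by rewrite /= x0 sup0.
Qed.

Lemma space_normD E x y : in_space E x -> in_space E y ->
  in_space E (x + y) /\
  space_norm E (x + y) <= space_norm E x + space_norm E y.
Proof.
case: E => [p p1|cx cy]; first exact: ellD.
have xy i : normc ((x + y) i) <= normc (x i) + normc (y i).
  exact: normc_triangle.
split; last first.
  apply: c_zero_ub; first by rewrite addr_ge0 ?space_norm_ge0.
  by move=> i; rewrite (le_trans (xy i))// lerD ?c_zero_le.
move=> eps e0; have e20 : 0 < eps / 2 by rewrite divr_gt0.
have fxy := conj (cx _ e20) (cy _ e20); rewrite -finite_setU in fxy.
apply: sub_finite_set fxy => i /= ei.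
apply: contrapT => /not_orP[/negP + /negP]; rewrite -!ltNge => xi yi.
have := le_lt_trans (le_trans ei (xy i)) (ltrD xi yi).
by rewrite -splitr ltxx.
Qed.

Lemma space_normZ_le E (a : R[i]) x : in_space E x ->
  in_space E (a *: x) /\ space_norm E (a *: x) <= normc a * space_norm E x.
Proof.
case: E => [p p1 xf|cx].
  have p0 : 0 < p by exact: (lt_le_trans ltr01 p1).
  apply: psum_norm_le; first by rewrite mulr_ge0 ?normc_ge0 ?powR_ge0.
  apply: (le_trans (psumZ_le _ _ p0)).
  by rewrite (psum_norm p1 xf) -EFinM powRM ?normc_ge0 ?powR_ge0.
have ax i : normc ((a *: x) i) = normc a * normc (x i) by exact: normcM.
split; last first.
  apply: c_zero_ub; first by rewrite mulr_ge0 ?normc_ge0 ?space_norm_ge0.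
  by move=> i; rewrite ax ler_wpM2l ?normc_ge0 ?c_zero_le.
move=> eps e0; have [a0|a0] := eqVneq (normc a) 0.
  apply: (sub_finite_set _ (finite_set0 _)) => i /=.
  by rewrite ax a0 mul0r leNgt e0.
have {}a0 : 0 < normc a by rewrite lt_neqAle eq_sym a0 normc_ge0.
apply: (sub_finite_set _ (cx _ (divr_gt0 e0 a0))) => i /=.
by rewrite ax ler_pdivrMr// mulrC.
Qed.

Lemma space_norm0_eq0 E x : in_space E x -> space_norm E x = 0 -> x = 0.
Proof.
case: E => [p p1|cx x0]; first exact: ell_norm0_eq0.
apply/funext => i; apply: eq0_normc; apply/eqP.
by rewrite eq_le normc_ge0 -x0 c_zero_le.
Qed.

Lemma space_normZ E (a : R[i]) x : in_space E x ->
  space_norm E (a *: x) = normc a * space_norm E x.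
Proof.
move=> Ex; have [Eax le_ax] := space_normZ_le a Ex.
apply/eqP; rewrite eq_le le_ax/=.
have [->|a0] := eqVneq a 0.
  rewrite normc0 mul0r; apply: space_norm_ge0.
  exact: (space_normZ_le 0 Ex).1.
have na0 : 0 < normc a.
  by rewrite lt_neqAle normc_ge0 andbT eq_sym; apply: contra_neq a0 => /eq0_normc.
have [_] := space_normZ_le a^-1 Eax.
by rewrite scalerA mulVf// scale1r normcV ler_pdivlMl.
Qed.

Lemma in_space0 E : in_space E 0.
Proof.
have n0 i : normc ((0 : X -> R[i]) i) = 0 by exact: normc0.
case: E => [p p1|eps e0]; last first.
  apply: (sub_finite_set _ (finite_set0 _)) => i h.
  have : eps <= 0 by rewrite -(n0 i).
  by rewrite leNgt e0.
rewrite /= /psum esum1 ?ltry// => i _.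
by rewrite n0 powR0// gt_eqF// (lt_le_trans ltr01).
Qed.

End SpaceNorm.

(* E(X), the complex families indexed by X that lie in E, with the norm of E. *)
Section SequenceSpace.
Variables (R : realType) (E : space_kind R) (X : choiceType).

Definition in_spaceb : {pred X -> R[i]} := fun x => `[< in_space E x >].

Record seq_space := SeqSpace {
  seq_val :> X -> R[i];
  seq_valP : seq_val \in in_spaceb }.

HB.instance Definition _ := [isSub for seq_val].
HB.instance Definition _ := [Choice of seq_space by <:].

Lemma in_spaceb_submod : submod_closed in_spaceb.
Proof.
split; first exact/asboolP/in_space0.
move=> a x y /asboolP Ex /asboolP Ey; apply/asboolP.
exact: (space_normD (space_normZ_le a Ex).1 Ey).1.
Qed.

HB.instance Definition _ :=
  GRing.isSubmodClosed.Build _ _ in_spaceb in_spaceb_submod.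
HB.instance Definition _ := [SubChoice_isSubLmodule of seq_space by <:].

Definition seq_norm (x : seq_space) : R[i] := (space_norm E x)%:C.

Lemma seq_in_space (x : seq_space) : in_space E x.
Proof. by case: x => x /= /asboolP. Qed.

Lemma seq_normD x y : seq_norm (x + y) <= seq_norm x + seq_norm y.
Proof.
rewrite /seq_norm -rmorphD lecR.
exact: (space_normD (seq_in_space x) (seq_in_space y)).2.
Qed.

Lemma seq_normZ (a : R[i]) x : seq_norm (a *: x) = `|a| * seq_norm x.
Proof. by rewrite /seq_norm (space_normZ a (seq_in_space x)) rmorphM. Qed.

Lemma seq_norm0_eq0 x : seq_norm x = 0 -> x = 0.
Proof.
by move=> [x0]; apply: val_inj; exact: space_norm0_eq0 (seq_in_space x) x0.
Qed.

HB.instance Definition _ :=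
  Lmodule_isNormed.Build R[i] seq_space seq_normD seq_normZ seq_norm0_eq0.

End SequenceSpace.

Section LinearGeometry.
Variables (K : numFieldType) (V : normedModType K).
Implicit Types (S H : set V) (v : V).

Definition linear_span S : set V :=
  [set x | exists k (a : 'I_k -> K) (v : 'I_k -> V),
    (forall i, S (v i)) /\ x = \sum_(i < k) a i *: v i].

Definition linear_subspace H : Prop :=
  [/\ H 0, forall x y, H x -> H y -> H (x + y) & forall a x, H x -> H (a *: x)].

Definition closed_hyperplane H : Prop :=
  [/\ linear_subspace H, closed H &
      exists2 v, ~ H v & forall x, exists a, H (x - a *: v)].

(* Points of P(V) are the lines of V through the origin. *)
Definition proj_point v : set V := [set a *: v | a in [set: K]].

Definition proj_subset S : set (set V) :=
  [set proj_point v | v in S `\ 0].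

Definition form_vanishes_on (f : V -> K) (P : set (set V)) : Prop :=
  forall L, P L -> forall x, L x -> f x = 0.

End LinearGeometry.

Section Pluecker.
Variables (K : comNzRingType) (n : nat).

Definition subsets_of_size : Type := {I : {fset nat} | #|` I| == n}.
HB.instance Definition _ := SubType.on subsets_of_size.
HB.instance Definition _ := Choice.on subsets_of_size.

Implicit Type w : subsets_of_size -> K.

Definition inversions (s : seq nat) : nat :=
  (\sum_(j < size s) \sum_(i < j) (nth 0 s j < nth 0 s i))%N.

(* The alternating extension of w at an n-tuple s: zero if s has a repeated
   entry, and otherwise w at the set of entries of s, times the sign of the
   permutation that sorts s. *)
Definition alternating_ext w (s : seq nat) : K :=
  if uniq s then
    if insub [fset i in s]%fset is Some J then (-1) ^+ inversions s * w J else 0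
  else 0.

Definition pluecker_relations w : Prop :=
  forall (r : n.-1.-tuple nat) (s : n.+1.-tuple nat),
    \sum_(t < n.+1) (-1) ^+ t.+1 * alternating_ext w (rcons r (tnth s t)) *
                     alternating_ext w (take t s ++ drop t.+1 s) = 0.

End Pluecker.

Definition decomposable_cone (R : realType) (E : space_kind R) (n : nat) :
    set (seq_space E (subsets_of_size n)) :=
  [set w | pluecker_relations w].
Arguments decomposable_cone {R} E n.

Definition pluecker_image (R : realType) (E : space_kind R) (n : nat) :
    set (set (seq_space E (subsets_of_size n))) :=
  proj_subset (decomposable_cone E n).
Arguments pluecker_image {R} E n.

(* Main.v *)
(** The coordinate family of a single subset J (1 at J, 0 elsewhere) satisfies
    the Pluecker relations: a relation has either no nonzero term or exactly
    two, which are opposite.  These families span all finitely supported ones,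
    which are dense in E since tails of elements of E are small in norm.  A
    closed hyperplane, or the kernel of a continuous linear form, that contains
    the Pluecker image contains these families, hence is the whole space. *)
Require Import Defs.
From mathcomp Require Import all_boot all_order all_algebra.
From mathcomp Require Import finmap complex zify ring.
From mathcomp Require Import all_classical all_reals all_analysis.

Import Order.TTheory GRing.Theory Num.Theory.
Import numFieldNormedType.Exports.

Local Open Scope classical_set_scope.
Local Open Scope ring_scope.
Local Open Scope complex_scope.

Definition unit_family (K : comNzRingType) (X : eqType) (J I : X) : K :=
  (I == J)%:R.
Arguments unit_family K {X} J I.

(** * Signs of tuples and the Pluecker relations for coordinate families *)

Section Signs.
Set Implicit Arguments.
Unset Strict Implicit.

Lemma inversions_cons (x : nat) (s : seq nat) :
  inversions (x :: s) = (count (fun y => y < x)%N s + inversions s)%N.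
Proof.
rewrite /inversions big_ord_recl big_ord0 add0n -sum1_count.
rewrite [X in _ = (X + _)%N]big_mkcond/= (big_nth 0%N) big_mkord -big_split/=.
by apply: eq_bigr => j _; rewrite big_ord_recl /=; congr addn; case: ltnP.
Qed.

(** The inserted [x] forms an inversion with each larger entry before it and each smaller entry
    after it. *)
Lemma inversions_insert (a b : seq nat) (x : nat) :
  inversions (a ++ x :: b) =
  (inversions (a ++ b) + count (fun y => x < y)%N a +
   count (fun y => y < x)%N b)%N.
Proof.
elim: a => [|y a IH] /=; first by rewrite inversions_cons addn0 addnC.
by rewrite !inversions_cons IH !count_cat/=; lia.
Qed.

(* Counting the entries larger than [x] in [a] as [size a] minus the smaller
   ones makes the sign of an insertion depend on the position only through
   [size a]. *)
Lemma sign_inversions_insert (K : comNzRingType) (a b : seq nat) (x : nat) :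
  x \notin a ->
  (-1) ^+ inversions (a ++ x :: b) =
  (-1) ^+ (size a + inversions (a ++ b) + count (fun y => y < x)%N (a ++ b))
    :> K.
Proof.
move=> xa; rewrite inversions_insert count_cat.
have -> : count (fun y => x < y)%N a = (size a - count (fun y => y < x)%N a)%N.
  rewrite -(count_predC (fun y => y < x)%N a) addKn; apply: eq_in_count => y ya.
  by rewrite /= -leqNgt ltn_neqAle; case: eqVneq xa => // ->; rewrite ya.
have := count_size (fun y => y < x)%N a.
set p := count _ a; set q := count _ b; set i := inversions _ => ps.
rewrite -signr_odd -[RHS]signr_odd; congr (_ ^+ nat_of_bool _).
rewrite !oddD oddB//.
by case: (odd i); case: (odd p); case: (odd q); case: (odd (size a)).
Qed.

(** [unbump i] closes the gap left at [i], so it gives the new position of each surviving entry. *)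
Lemma nth_delete (T : Type) (x0 : T) (s : seq T) (i k : nat) :
  (i < size s)%N -> i != k ->
  nth x0 (take i s ++ drop i.+1 s) (unbump i k) = nth x0 s k.
Proof.
move=> si ik; rewrite nth_cat size_take si /unbump.
have [ki|ki] := ltnP k i.
  by rewrite (ltnNge i) (ltnW ki) subn0 ki nth_take.
have {}ki : (i < k)%N by rewrite ltn_neqAle ik.
rewrite ki subn1 ifF; last by apply/negbTE; lia.
by rewrite nth_drop; congr nth; lia.
Qed.

Variables (K : comNzRingType) (n : nat).
Implicit Types (w : subsets_of_size n -> K) (a b c s : seq nat).

Lemma alternating_ext_uniq w s : alternating_ext w s != 0 -> uniq s.
Proof. by rewrite /alternating_ext; case: ifP; rewrite ?eqxx. Qed.

(** With a repeated entry both sides are zero. Otherwise both tuples arise by inserting [x] into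
    [a ++ b ++ c], and the two insertion signs differ only through the lengths of [a ++ b] and
    [a]. *)
Lemma alternating_ext_move w a b c x :
  alternating_ext w (a ++ b ++ x :: c) =
  (-1) ^+ size b * alternating_ext w (a ++ x :: b ++ c).
Proof.
have pE : perm_eq (a ++ b ++ x :: c) (a ++ x :: b ++ c).
  by rewrite perm_cat2l -cat1s perm_catCA.
rewrite /alternating_ext (perm_uniq pE).
have -> : [fset i in a ++ b ++ x :: c]%fset = [fset i in a ++ x :: b ++ c]%fset.
  by apply/fsetP => i; have := perm_mem pE i; rewrite !(mem_cat, inE).
case: ifP => [us|_]; last by rewrite mulr0.
case: insub => [J|]; last by rewrite mulr0.
rewrite mulrA; congr (_ * _).
have xab : x \notin a ++ b.
  move: us; rewrite -(perm_uniq pE) catA cat_uniq => /and3P[_ /hasPn h _].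
  by apply: h; rewrite inE eqxx.
rewrite catA sign_inversions_insert// -catA sign_inversions_insert; last first.
  by move: xab; rewrite mem_cat => /norP[].
by rewrite size_cat !exprD; ring.
Qed.

(** Write [s] as [a ++ x :: b ++ x :: c]. The two deletions leave [a ++ b ++ x :: c] and
    [a ++ x :: b ++ c], which differ by moving [x] across the [j - i.+1] entries of [b]. *)
Lemma alternating_ext_delete w s i j : (i < j < size s)%N ->
  nth 0%N s i = nth 0%N s j ->
  (-1) ^+ i.+1 * alternating_ext w (take i s ++ drop i.+1 s) +
  (-1) ^+ j.+1 * alternating_ext w (take j s ++ drop j.+1 s) = 0.
Proof.
move=> /andP[ij js] eij.
pose a := take i s; pose b := take (j - i.+1) (drop i.+1 s).
pose c := drop j.+1 s; pose x := nth 0%N s j.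
have sb : size b = (j - i.+1)%N by rewrite size_take size_drop; case: ifP; lia.
have di : drop i.+1 s = b ++ x :: c.
  rewrite -[LHS](cat_take_drop (j - i.+1)) drop_drop subnK//.
  by rewrite (drop_nth 0%N js).
have tj : take j s = a ++ x :: b.
  rewrite -(cat_take_drop i (take j s)) take_takel; last exact: ltnW.
  congr (_ ++ _); rewrite (drop_nth 0%N);
    last by rewrite size_take; case: ifP; lia.
  rewrite nth_take// eij; congr (_ :: _).
  by rewrite /b take_drop subnK.
rewrite di tj -/a -/c -catA alternating_ext_move sb mulrA -exprD -mulrDl.
(* The exponents are now [j] and [j.+1], so the two terms are opposite. *)
have -> : (i.+1 + (j - i.+1) = j)%N by lia.
by rewrite exprS mulN1r addrN mul0r.
Qed.

Lemma alternating_ext_unit (J : subsets_of_size n) s :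
  alternating_ext (unit_family K J) s != 0 ->
  uniq s /\ s =i (val J : {fset nat}).
Proof.
rewrite /alternating_ext; case: ifP => [us|_]; last by rewrite eqxx.
case: insubP => [I _ vI|_]; last by rewrite eqxx.
rewrite /unit_family; have [IJ _|_] := eqVneq I J; last by rewrite mulr0 eqxx.
by split=> // i; rewrite -IJ vI !inE.
Qed.

(* A nonzero term at [t] forces [s_t = s_u] for some [u <> t]; the terms at [t]
   and [u] are opposite, and every other term vanishes because its second factor
   still has the repeated entry. *)
Lemma unit_family_pluecker (J : subsets_of_size n) :
  pluecker_relations (unit_family K J).
Proof.
move=> r s; pose w := unit_family K J.
pose F (t : 'I_n.+1) := (-1) ^+ t.+1 * alternating_ext w (rcons r (tnth s t)) *
  alternating_ext w (take t s ++ drop t.+1 s).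
rewrite -[LHS]/(\sum_t F t).
have [/forallP F0|] := boolP [forall t, F t == 0].
  by rewrite big1// => t _; exact/eqP.
rewrite negb_forall => /existsP[t Ft].
have FP v : F v != 0 -> alternating_ext w (rcons r (tnth s v)) != 0
    /\ alternating_ext w (take v s ++ drop v.+1 s) != 0.
  move=> h; split; apply: contra_neq h => h; rewrite /F h ?mulr0 ?mul0r//.
have sN v : tnth s v = nth 0%N s v by exact: tnth_nth.
(* Both factors at [t] are nonzero, so both tuples enumerate [J]. As [s_t] occurs in the first, it
   also occurs in [s] with position [t] deleted. *)
have [u ut su] : exists2 u, u != t & tnth s u = tnth s t.
  have [/alternating_ext_unit[_ rt] /alternating_ext_unit[_ dt]] := FP _ Ft.
  have : tnth s t \in take t s ++ drop t.+1 s.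
    by rewrite dt -rt mem_rcons mem_head.
  rewrite mem_cat => /orP[] /(nthP 0%N)[k].
    rewrite size_take size_tuple ltn_ord => kt; rewrite nth_take// => kE.
    have kn : (k < n.+1)%N by exact: ltn_trans kt _.
    by exists (Ordinal kn); [rewrite -val_eqE/= ltn_eqF | rewrite sN].
  rewrite size_drop size_tuple nth_drop => kt kE.
  have kn : (t.+1 + k < n.+1)%N by lia.
  exists (Ordinal kn); last by rewrite sN.
  by rewrite -val_eqE/= gtn_eqF// addSn ltnS leq_addr.
rewrite (bigD1 t)//= (bigD1 u)//= big1 ?addr0; last first.
  move=> v /andP[vt vu]; apply/eqP/negPn/negP => Fv.
  have [_ /alternating_ext_uniq] := FP _ Fv.
  move=> /(uniqP 0%N) inj; move: ut; rewrite -val_eqE => /eqP; apply.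
  have del k : k != v -> (unbump v k < n)%N.
    rewrite -val_eqE/= /unbump; have := ltn_ord k; have := ltn_ord v.
    by case: ltnP; lia.
  (* Positions [t] and [u] survive the deletion of [v] and carry equal entries. Uniqueness
     identifies their new positions, and [unbump v] is injective away from [v]. *)
  apply: (can_in_inj (D1 := predC1 (val v)) (@unbumpK v)).
  - by rewrite inE/= val_eqE eq_sym.
  - by rewrite inE/= val_eqE eq_sym.
  have sz : size (take v s ++ drop v.+1 s) = n.
    rewrite size_cat size_take size_drop size_tuple ltn_ord.
    by have := ltn_ord v; lia.
  apply: inj; rewrite ?inE ?sz ?del 1?eq_sym//.
  by rewrite !nth_delete ?size_tuple -?sN ?su// eq_sym.
(* Since [s_t = s_u], the two terms share their first factor; what remains is the sum of two signed
   deletions. *)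
rewrite /F su -!mulrA ![alternating_ext _ (rcons _ _) * _]mulrC !mulrA -mulrDl.
have [ltut|lttu] := ltnP t u.
  by rewrite alternating_ext_delete ?mul0r -?sN ?su// ltut size_tuple/=.
have {}lttu : (u < t)%N by rewrite ltn_neqAle lttu andbT.
by rewrite addrC alternating_ext_delete ?mul0r -?sN ?su// lttu size_tuple/=.
Qed.
End Signs.

(** * Approximation by finite supports and density of spans *)

Section Density.
Set Implicit Arguments.
Unset Strict Implicit.
Variables (R : realType).

Section Sequences.
Variables (E : space_kind R) (X : choiceType).

(** The tail outside [A]: the error left when [x] is replaced by its restriction to [A]. *)
Definition truncation (A : {fset X}) (x : X -> R[i]) : X -> R[i] :=
  fun i => if i \in A then 0 else x i.

(** Some finite partial sum comes within [eps] of the supremum defining the total; being finite, it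
    can be cancelled. *)
Lemma esum_tail (f : X -> \bar R) (eps : R) : 0 < eps ->
  (forall i, 0 <= f i)%E -> (\esum_(i in [set: X]) f i < +oo)%E ->
  exists A : {fset X}, (\esum_(i in ~` [set` A]) f i <= eps%:E)%E.
Proof.
move=> e0 f0 fy.
have ffin : \esum_(i in [set: X]) f i \is a fin_num.
  by rewrite ge0_fin_numE ?esum_ge0.
have [_ [A [finA _] <-]] := ub_ereal_sup_adherent e0 ffin.
rewrite -/(esum _ _) -(esum_fset finA)// => lt.
exists (fset_set A); rewrite fset_setK//.
move: lt; rewrite (esumID A)// setTI => lt.
have Afin : \esum_(i in A) f i \is a fin_num.
  rewrite ge0_fin_numE ?esum_ge0//; apply: le_lt_trans fy.
  by rewrite [leRHS](esumID A)// setTI leeDl// esum_ge0.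
move: lt; rewrite setTI lteBlDr// lteD2lE//; exact: ltW.
Qed.

(** For [ell p], the tail of the sum of [p]-th powers is made at most [eps] to the power [p]. For
    [c_zero], the finitely many coordinates of modulus at least [eps] are removed. *)
Lemma space_norm_tail (x : X -> R[i]) (eps : R) : 0 < eps -> in_space E x ->
  exists A : {fset X}, space_norm E (truncation A x) <= eps.
Proof.
move=> e0; case: E => [p p1 /= xE|/= xE].
  have p0 : 0 < p by exact: (lt_le_trans ltr01 p1).
  have [A hA] := esum_tail (powR_gt0 p e0)
    (fun i => powR_ge0 (ComplexField.Normc.normc (x i)) p : (0 <= _%:E)%E) xE.
  exists A; apply: (psum_norm_le p1 (ltW e0) _).2; apply: le_trans hA.
  rewrite [leRHS]esum_mkcond; apply: le_esum => i _.
  rewrite /truncation; case: ifPn => iA.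
    rewrite ComplexField.Normc.normc0 powR0 ?gt_eqF//.
    by case: ifP => // _; rewrite lee_fin powR_ge0.
  by rewrite ifT// inE/=; exact/negP.
exists (fset_set [set i | eps <= ComplexField.Normc.normc (x i)]).
apply: c_zero_ub; first exact: ltW.
move=> i; rewrite /truncation in_fset_set; last exact: xE.
case: ifPn => [_|]; first by rewrite ComplexField.Normc.normc0 ltW.
by rewrite notin_setE/= => /negP; rewrite -ltNge => /ltW.
Qed.

Lemma unit_family_in_space J : unit_family R[i] J \in in_spaceb E (X := X).
Proof.
apply/asboolP; case: E => [p p1|eps e0] /=.
  rewrite /psum (esumID [set J]); last by move=> i _; rewrite lee_fin powR_ge0.
  rewrite setTI esum_set1 ?lee_fin ?powR_ge0// esum1 ?adde0 ?ltry//.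
  move=> i [_ /eqP/negPf iJ].
  rewrite /unit_family iJ ComplexField.Normc.normc0 powR0// gt_eqF//.
  exact: (lt_le_trans ltr01 p1).
apply: (sub_finite_set _ (finite_set1 J)) => i /=.
rewrite /unit_family; case: eqP => // _; rewrite ComplexField.Normc.normc0.
by rewrite leNgt e0.
Qed.

Definition unit_seq J : seq_space E X := SeqSpace (unit_family_in_space J).

Lemma unit_seq_neq0 J : unit_seq J <> 0.
Proof.
move=> /(congr1 (fun u : seq_space E X => u J)) /=.
by rewrite /unit_family eqxx => /eqP; rewrite oner_eq0.
Qed.

Lemma seq_val_sum_unit (A : seq X) (x : X -> R[i]) : uniq A ->
  seq_val (\sum_(J <- A) x J *: unit_seq J) =
  fun I => if I \in A then x I else 0.
Proof.
move=> uA; apply/funext => I.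
have -> : seq_val (\sum_(J <- A) x J *: unit_seq J) =
    \sum_(J <- A) x J *: unit_family R[i] J.
  rewrite -[LHS]/(\val _) raddf_sum; exact: eq_bigr.
have dE J : (x J *: unit_family R[i] J) I = x J * (I == J)%:R by [].
rewrite fct_sumE; case: ifPn => IA.
  rewrite (bigD1_seq I)//= big1 ?addr0 ?dE ?eqxx ?mulr1// => J JI.
  by rewrite dE eq_sym (negPf JI) mulr0.
rewrite big_seq big1// => J JA; rewrite dE.
by case: eqP IA JA => [<- /negPf->|]; rewrite ?mulr0.
Qed.

Lemma linear_span_sum (V : normedModType R[i]) (S : set V) (T : Type)
    (A : seq T) (a : T -> R[i]) (v : T -> V) : (forall J, S (v J)) ->
  linear_span S (\sum_(J <- A) a J *: v J).
Proof.
move=> Sv; exists (size A), (a \o tnth (in_tuple A)), (v \o tnth (in_tuple A)).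
by split=> [i|]; [exact: Sv|rewrite big_tnth].
Qed.

Variables (S : set (seq_space E X)) (Sunit : forall J, S (unit_seq J)).

Lemma linear_span_finite_support (x : X -> R[i]) :
  finite_set [set J | x J != 0] ->
  exists2 w : seq_space E X, linear_span S w & seq_val w = x.
Proof.
move=> finx; pose A := fset_set [set J | x J != 0].
exists (\sum_(J <- A) x J *: unit_seq J); first exact: linear_span_sum.
rewrite seq_val_sum_unit ?fset_uniq//; apply/funext => I.
case: ifPn => //; rewrite in_fset_set// notin_setE/= => /negP.
by rewrite negbK => /eqP.
Qed.

(** The set [S] is kept general: the lemma serves both for the whole cone and for the coordinate
    families alone. *)
Lemma linear_span_dense : dense (linear_span S).
Proof.
move=> O [w Ow] oO.
have /nbhs_ballP[e e0 eO] := open_nbhs_nbhs (conj oO Ow).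
(* Radii of balls are complex scalars; positivity in the order of [R[i]] forces the imaginary part
   to vanish. *)
have [r r0 er] : exists2 r : R, 0 < r & e = r%:C.
  move: e0; rewrite /= ltcE/= => /andP[/eqP e_real r0].
  exists (complex.Re e) => //.
  by case: e e_real {r0 eO} => a b /= ->.
(* Half the radius turns the weak bound on the tail into the strict one that the ball requires. *)
have [A hA] := space_norm_tail (divr_gt0 r0 (ltr0n R 2)) (seq_in_space w).
pose u : seq_space E X := \sum_(J <- A) w J *: unit_seq J.
exists u; split; last exact: linear_span_sum.
apply: eO; rewrite -ball_normE/= er.
have -> : `|w - u| = (space_norm E (truncation A w))%:C.
  congr (space_norm E _)%:C; apply/funext => I.
  have -> : seq_val (w - u) I = w I - seq_val u I by [].
  rewrite seq_val_sum_unit ?fset_uniq// /truncation.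
  by case: ifP => _; rewrite ?subrr ?subr0.
rewrite ltcR; apply: le_lt_trans hA _.
by rewrite ltr_pdivrMr// ltr_pMr// ltr1n.
Qed.

End Sequences.
End Density.

Theorem proposition4p1 (R : realType) (E : space_kind R) (n : nat)
    (hn : (1 <= n)%N) :
  let V := seq_space E (subsets_of_size n) in
  let C : set V := decomposable_cone E n in
  let G : set (set V) := pluecker_image E n in
  [/\ dense (linear_span C),
      forall x : subsets_of_size n -> R[i], finite_set [set J | x J != 0] ->
        exists2 w : V, linear_span C w & seq_val w = x,
      forall H : set V, closed_hyperplane H -> ~ (G `<=` [set L | L `<=` H]) &
      forall f : {linear V -> R[i]^o}, continuous f ->
        form_vanishes_on f G -> forall w : V, f w = 0].
Proof.
move=> V C G.
have CU J : C (unit_seq E J) by exact: (@unit_family_pluecker _ _ J).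
have GU J : G (proj_point (unit_seq E J : V)).
  by exists (unit_seq E J) => //; split; [exact: CU|exact: unit_seq_neq0].
have U1 J : proj_point (unit_seq E J : V) (unit_seq E J).
  by exists 1; rewrite ?scale1r.
(* If the open complement of [H] were nonempty, it would meet the dense span of the coordinate
   families, which lies in [H]. *)
have dense_closed (H : set V) : linear_subspace H -> closed H ->
    (forall J, H (unit_seq E J)) -> H = setT.
  move=> linH clH HU; apply/seteqP; split=> // w _; apply: contrapT => Hw.
  have [u [nHu [k [a [v [Uv uE]]]]]] :=
    linear_span_dense (S := [set unit_seq E J | J in setT])
      (fun J => ex_intro2 _ _ J I erefl) (ex_intro _ w Hw) (closed_openC clH).
  apply: nHu; rewrite uE; have [H0 HD HZ] := linH.
  by elim/big_ind : _ => // i _; apply: HZ; have [J _ <-] := Uv i.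
split; first exact: linear_span_dense.
- exact: linear_span_finite_support.
- move=> H [linH clH [v Hv _]] GH; apply: Hv.
  by rewrite (dense_closed H linH clH) // => J; exact: (GH _ (GU J)).
- move=> f cf fG w.
  suff : [set w | f w = 0] = setT by move=> /seteqP[_ /(_ w I)].
  apply: dense_closed.
  + split=> [|x y /= fx fy|a x /= fx]; rewrite /=.
    * exact: linear0.
    * by rewrite linearD fx fy addr0.
    * by rewrite linearZ fx; exact: scaler0.
  + rewrite -[X in closed X]/(f @^-1` [set 0]).
    apply: preimage_closed => //;
      exact/accessible_closed_set1/hausdorff_accessible/norm_hausdorff.
  + by move=> J; exact: (fG _ (GU J)).
Qed.
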